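(* Let $0\ne T\ne I_X$ in $\mathcal{B}(X)$ have non-zero left and right annihilators, and let $T=\begin{bmatrix}T_1&T_2\\ 0&0\end{bmatrix}$ in $X=\mathcal{K}\oplus\mathcal{L}$ be a local block representation of $T$. Suppose that (a) $T_1$ is an idempotent $\ne I_{\mathcal{K}}$; (b) either $\mathcal{N}(T_2)\ne\{0\}$ or $\mathcal{R}(T_1)\cap\mathcal{R}(T_2)\ne\{0\}$; (c) $\dim\mathcal{L}\ge2$. Then: (i) There exist uncountably many idempotents $D\in\mathcal{B}(\mathcal{L})$ with $\{0\}\ne\mathcal{N}(D)\ne\mathcal{L}$ and $\mathcal{N}(D)\subset\mathcal{N}(T_2-T_1T_2)$. (ii) For any $D$ as in (i), $T$ is expressed as a product of two idempotents as (a) $T=E_1E_2$ and (b) $T=E_1'E_2$, where $$E_1=\begin{bmatrix}I_{\mathcal{K}}&T_2\\ 0&0\end{bmatrix},\quad E_2=\begin{bmatrix}T_1&T_2(I_{\mathcal{L}}-D)\\ 0&D\end{bmatrix},\quad E_1'=\begin{bmatrix}I_{\mathcal{K}}&T_2D\\ 0&0\end{bmatrix}.$$ (iii) $E_1=E_1'$ if and only if $\mathcal{N}(D)\subset\mathcal{N}(T_2)$, and this implies $\mathcal{N}(T_2)\ne\{0\}$. (iv) For distinct $D$'s as in (i), the corresponding $E_2$'s are distinct. (v) $T$ can be expressed as a product of two idempotents in uncountably many ways.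
   Context: $X$ is a complex Banach space; $\mathcal{B}(X_1,X_2)$ denotes the bounded linear maps $X_1\to X_2$, $\mathcal{B}(X)=\mathcal{B}(X,X)$; $\mathcal{R}(\cdot)$ and $\mathcal{N}(\cdot)$ denote range and null space. A non-zero left (right) annihilator of $T$ is a non-zero $A\in\mathcal{B}(X)$ with $AT=0$ ($TA=0$). ''$X=\mathcal{K}\oplus\mathcal{L}$, a topological sum'' means $\mathcal{K},\mathcal{L}$ are closed subspaces, both different from $\{0\}$ and $X$, with $\mathcal{K}\cap\mathcal{L}=\{0\}$, $\mathcal{K}+\mathcal{L}=X$ and bounded associated projections. Operators are written in block form $\begin{bmatrix}A_1&A_2\\ A_3&A_4\end{bmatrix}$ with $A(k+l)=(A_1k+A_2l)+(A_3k+A_4l)$ for $k\in\mathcal{K}$, $l\in\mathcal{L}$. A local block representation of $T$ is its block form $\begin{bmatrix}T_1&T_2\\ 0&0\end{bmatrix}$ with respect to a topological sum $X=\mathcal{K}\oplus\mathcal{L}$ such that $\mathcal{K}$ contains the closure of $\mathcal{R}(T)$. The dimension of a Banach space is the smallest cardinality of a subset with dense linear span. *)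

(* Defs.v *)
From HB Require Import structures.
From mathcomp Require Import all_boot all_order all_algebra.
From mathcomp Require Export complex.
From mathcomp Require Import all_classical all_reals all_analysis.

Set Implicit Arguments.
Unset Strict Implicit.
Unset Printing Implicit Defensive.

Import Order.TTheory GRing.Theory Num.Theory.
Import numFieldNormedType.Exports.

Local Open Scope classical_set_scope.
Local Open Scope ring_scope.

Section BoundedOperators.
Variable C : numFieldType.

Definition bounded_map (V W : normedModType C) (f : V -> W) : Prop :=
  exists M : C, forall x, `|f x| <= M * `|x|.

Record bop (V W : normedModType C) := Bop {
  bop_linear :> {linear V -> W};
  bop_bounded : bounded_map bop_linear
}.

Definition mk_bop (V W : normedModType C) (f : V -> W)
    (lf : linear f) (bf : bounded_map f) : bop V W :=
  @Bop V W (HB.pack f (GRing.isLinear.Build _ _ _ _ f lf)) bf.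

Lemma bopP (V W : normedModType C) (A B : bop V W) : A =1 B -> A = B.
Proof.
case: A B => [[a ha] ba] [[b hb] bb] /= /funext ab.
case: _ / ab in hb bb *.
case: ha bb ba => [[h1] [h2]] bb ba; case: hb bb => [[h3] [h4]] bb.
rewrite (Prop_irrelevance h3 h1) (Prop_irrelevance h4 h2) in bb *.
by rewrite (Prop_irrelevance ba bb).
Qed.

HB.instance Definition _ (V W : normedModType C) := gen_eqMixin (bop V W).
HB.instance Definition _ (V W : normedModType C) := gen_choiceMixin (bop V W).

Section Zmodule.
Variables V W : normedModType C.

Lemma bop_zero_linear : linear (fun _ : V => 0 : W).
Proof. by move=> a u v; rewrite scaler0 addr0. Qed.

Lemma bop_zero_bounded : bounded_map (fun _ : V => 0 : W).
Proof. by exists 0 => x; rewrite normr0 mul0r. Qed.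

Definition bop_zero : bop V W := mk_bop bop_zero_linear bop_zero_bounded.

Lemma bop_opp_linear (A : bop V W) : linear (fun x => - A x).
Proof. by move=> a u v; rewrite linearP opprD scalerN. Qed.

Lemma bop_opp_bounded (A : bop V W) : bounded_map (fun x => - A x).
Proof. by have [M hM] := bop_bounded A; exists M => x; rewrite normrN. Qed.

Definition bop_opp A : bop V W :=
  mk_bop (bop_opp_linear A) (bop_opp_bounded A).

Lemma bop_add_linear (A B : bop V W) : linear (fun x => A x + B x).
Proof. by move=> a u v; rewrite !linearP scalerDr addrACA. Qed.

Lemma bop_add_bounded (A B : bop V W) : bounded_map (fun x => A x + B x).
Proof.
have [M hM] := bop_bounded A; have [N hN] := bop_bounded B.
exists (M + N) => x; rewrite mulrDl.
exact: le_trans (ler_normD _ _) (lerD (hM x) (hN x)).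
Qed.

Definition bop_add A B : bop V W :=
  mk_bop (bop_add_linear A B) (bop_add_bounded A B).

Lemma bop_addA : associative bop_add.
Proof. by move=> A B D; apply: bopP => x /=; rewrite addrA. Qed.

Lemma bop_addC : commutative bop_add.
Proof. by move=> A B; apply: bopP => x /=; rewrite addrC. Qed.

Lemma bop_add0 : left_id bop_zero bop_add.
Proof. by move=> A; apply: bopP => x /=; rewrite add0r. Qed.

Lemma bop_addN : left_inverse bop_zero bop_opp bop_add.
Proof. by move=> A; apply: bopP => x /=; rewrite addNr. Qed.

HB.instance Definition _ :=
  GRing.isZmodule.Build (bop V W) bop_addA bop_addC bop_add0 bop_addN.

Lemma bop0E (x : V) : (0 : bop V W) x = 0. Proof. by []. Qed.
Lemma bopDE (A B : bop V W) x : (A + B) x = A x + B x. Proof. by []. Qed.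
Lemma bopNE (A : bop V W) x : (- A) x = - A x. Proof. by []. Qed.
Lemma bopBE (A B : bop V W) x : (A - B) x = A x - B x. Proof. by []. Qed.

End Zmodule.

Lemma bop_id_linear (V : normedModType C) : linear (fun x : V => x).
Proof. by []. Qed.

Lemma bop_id_bounded (V : normedModType C) : bounded_map (fun x : V => x).
Proof. by exists 1 => x; rewrite mul1r. Qed.

Definition bop_id (V : normedModType C) : bop V V :=
  mk_bop (@bop_id_linear V) (@bop_id_bounded V).

Section Composition.
Variables U V W : normedModType C.

Lemma bop_comp_linear (A : bop V W) (B : bop U V) : linear (fun x => A (B x)).
Proof. by move=> a u v; rewrite !linearP. Qed.

Lemma bop_comp_bounded (A : bop V W) (B : bop U V) :
  bounded_map (fun x => A (B x)).
Proof.
have [M hM] := bop_bounded A; have [N hN] := bop_bounded B.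
exists (`|M| * N) => x; rewrite -mulrA.
apply: (le_trans _ (ler_wpM2l (normr_ge0 M) (hN x))).
have hMB := hM (B x).
have := ger0_norm (le_trans (normr_ge0 _) hMB).
by rewrite normrM normr_id => ->.
Qed.

Definition bop_comp (A : bop V W) (B : bop U V) : bop U W :=
  mk_bop (bop_comp_linear A B) (bop_comp_bounded A B).

End Composition.

Definition bop_ker (V W : normedModType C) (A : bop V W) : set V :=
  [set x | A x = 0].

Definition idem_bop (V : normedModType C) (A : bop V V) : Prop :=
  bop_comp A A = A.

End BoundedOperators.

Notation "''B' ( V , W )" := (bop V W)
  (at level 8, format "''B' ( V ,  W )") : type_scope.
Notation "''B' ( V )" := (bop V V)
  (at level 8, format "''B' ( V )") : type_scope.
Notation "A \ob B" := (bop_comp A B)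
  (at level 40, left associativity) : ring_scope.

Section Dimension.
Variables (C : numFieldType) (V : normedModType C).

Definition linear_subspace (S : set V) : Prop :=
  S 0 /\ forall (a : C) u v, S u -> S v -> S (a *: u + v).

Definition linear_span (S : set V) : set V := smallest linear_subspace S.

(* The dimension of V is the least cardinality of a subset with dense linear
   span (not the cardinality of a Hamel basis), so that it is at least n
   exactly when every such subset has at least n elements. *)
Definition banach_dim_ge (n : nat) : Prop :=
  forall S : set V, dense (linear_span S) -> (`I_n #<= S)%card.

End Dimension.

Section ClosedSubspaces.
Variables (C : numFieldType) (X : normedModType C).

Record closed_subspace := ClosedSubspace {
  cs_set : set X;
  cs_linear : linear_subspace cs_set;
  cs_closed : closed cs_set
}.

Definition cs_pred (S : closed_subspace) : {pred X} := fun x => x \in cs_set S.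

Lemma cs_submod (S : closed_subspace) : submod_closed (cs_pred S).
Proof.
have [S0 SP] := cs_linear S; split; first exact: mem_set.
by move=> a u v /set_mem Su /set_mem Sv; apply/mem_set/SP.
Qed.

Definition cs_sort (S : closed_subspace) : Type := {x : X | cs_pred S x}.

End ClosedSubspaces.

Coercion cs_sort : closed_subspace >-> Sortclass.

Section ClosedSubspaceNormed.
Variables (C : numFieldType) (X : normedModType C) (S : closed_subspace X).

HB.instance Definition _ := Choice.on (cs_sort S).
HB.instance Definition _ := SubChoice.on (cs_sort S).
HB.instance Definition _ :=
  GRing.SubChoice_isSubLmodule.Build C X (cs_pred S) (cs_sort S) (cs_submod S).

Let cs_norm (x : cs_sort S) : C := `|val x|.

Lemma cs_normD x y : cs_norm (x + y) <= cs_norm x + cs_norm y.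
Proof. by rewrite /cs_norm raddfD ler_normD. Qed.

Lemma cs_normZ (l : C) x : cs_norm (l *: x) = `|l| * cs_norm x.
Proof. by rewrite /cs_norm linearZ normrZ. Qed.

Lemma cs_norm0 x : cs_norm x = 0 -> x = 0.
Proof. by move=> /eqP; rewrite normr_eq0 => /eqP x0; apply: val_inj. Qed.

HB.instance Definition _ :=
  Lmodule_isNormed.Build C (cs_sort S) cs_normD cs_normZ cs_norm0.

Lemma cs_incl_linear : linear (fun x : cs_sort S => val x).
Proof. by move=> a u v; rewrite linearP. Qed.

Lemma cs_incl_bounded : bounded_map (fun x : cs_sort S => val x).
Proof. by exists 1 => x; rewrite mul1r. Qed.

Definition cs_incl : 'B(cs_sort S, X) := mk_bop cs_incl_linear cs_incl_bounded.

End ClosedSubspaceNormed.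

Section TopologicalSums.
Variables (C : numFieldType) (X : normedModType C) (K L : closed_subspace X).

Record topological_sum : Prop := TopologicalSum {
  ts_left_neq0 : cs_set K <> [set 0];
  ts_left_neqT : cs_set K <> [set: X];
  ts_right_neq0 : cs_set L <> [set 0];
  ts_right_neqT : cs_set L <> [set: X];
  ts_meet : cs_set K `&` cs_set L = [set 0];
  ts_join : [set k + l | k in cs_set K & l in cs_set L] = [set: X];
  ts_left_proj :
    exists P : 'B(X, K), forall (k : K) (l : L), P (val k + val l) = k;
  ts_right_proj :
    exists Q : 'B(X, L), forall (k : K) (l : L), Q (val k + val l) = l
}.

Variable h : topological_sum.

(* blockE and block_unique show that the block operator does not depend on the
   choice of the projections. *)
Definition left_proj : 'B(X, K) := projT1 (cid (ts_left_proj h)).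
Definition right_proj : 'B(X, L) := projT1 (cid (ts_right_proj h)).

Lemma left_projE (k : K) (l : L) : left_proj (val k + val l) = k.
Proof. exact: (projT2 (cid (ts_left_proj h))). Qed.

Lemma right_projE (k : K) (l : L) : right_proj (val k + val l) = l.
Proof. exact: (projT2 (cid (ts_right_proj h))). Qed.

Definition block (A1 : 'B(K)) (A2 : 'B(L, K)) (A3 : 'B(K, L)) (A4 : 'B(L)) :
    'B(X) :=
  cs_incl K \ob (A1 \ob left_proj + A2 \ob right_proj) +
  cs_incl L \ob (A3 \ob left_proj + A4 \ob right_proj).

Lemma blockE (A1 : 'B(K)) (A2 : 'B(L, K)) (A3 : 'B(K, L)) (A4 : 'B(L))
    (k : K) (l : L) :
  block A1 A2 A3 A4 (val k + val l) =
  val (A1 k + A2 l) + val (A3 k + A4 l).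
Proof.
by rewrite /block /= left_projE right_projE.
Qed.

Lemma block_unique (A1 : 'B(K)) (A2 : 'B(L, K)) (A3 : 'B(K, L)) (A4 : 'B(L))
    (A : 'B(X)) :
  (forall (k : K) (l : L),
     A (val k + val l) = val (A1 k + A2 l) + val (A3 k + A4 l)) ->
  A = block A1 A2 A3 A4.
Proof.
move=> hA; apply: bopP => x.
have : [set: X] x by [].
rewrite -(ts_join h) => -[k Kk [l Ll <-]].
have := blockE A1 A2 A3 A4 (exist _ k (mem_set Kk)) (exist _ l (mem_set Ll)).
by rewrite -hA => /esym.
Qed.

Definition local_block_rep (T : 'B(X)) (T1 : 'B(K)) (T2 : 'B(L, K)) : Prop :=
  closure (range T) `<=` cs_set K /\ T = block T1 T2 0 0.

Definition admissible (T1 : 'B(K)) (T2 : 'B(L, K)) (D : 'B(L)) : Prop :=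
  [/\ idem_bop D, bop_ker D <> [set 0], bop_ker D <> [set: L] &
      bop_ker D `<=` bop_ker (T2 - T1 \ob T2)].

End TopologicalSums.

(* Main.v *)
(* Hypotheses (a) and (b) give u != 0 in N(T2 - T1 T2): take u in N(T2), or u
   with T2 u a non-zero element of R(T1).  As dim L >= 2, Hahn-Banach provides
   bounded functionals f, g on L with f(u) = 1, g(u) = 0, g != 0, so the rank-one
   perturbations I - (f + t g) (x) u, for t real, are uncountably many idempotents
   with null space spanned by u.  The factorisations are block computations, which
   rest on T1 T2 (I - D) = T2 (I - D).

   Hahn-Banach is obtained without extending functionals from subspaces: a
   minimal sublinear functional is linear, since for q minimal the functional
   y |-> inf_(t >= 0) (q(y + t x) - t q(x)) is sublinear and below q, hence equal
   to q, which gives q(y) <= q(y + x) - q(x). *)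
Require Import Defs.
From HB Require Import structures.
From mathcomp Require Import all_boot all_order all_algebra.
From mathcomp Require Import all_classical all_reals all_analysis.
From mathcomp Require Import ring.

Set Implicit Arguments.
Unset Strict Implicit.
Unset Printing Implicit Defensive.

Import Order.TTheory GRing.Theory Num.Theory.
Import numFieldNormedType.Exports.

Local Open Scope classical_set_scope.
Local Open Scope ring_scope.
Local Open Scope complex_scope.

(** * Hahn-Banach domination by sublinear functionals on a real vector space *)

Section HahnBanach.
Variables (R : realType) (V : lmodType R).
Implicit Types (p q : V -> R) (x y : V).

(* The inequality in the second clause self-improves to an equality, see
   [sublinearZ]. *)
Definition sublinear p : Prop :=
  (forall x y, p (x + y) <= p x + p y) /\
  (forall r x, 0 <= r -> p (r *: x) <= r * p x).

Lemma sublinear0_le p : sublinear p -> p 0 <= 0.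
Proof. by move=> [_ /(_ 0 0 (lexx _))]; rewrite scale0r mul0r. Qed.

Lemma sublinear_geN p x : sublinear p -> - p (- x) <= p x.
Proof.
move=> [pD _]; rewrite -subr_ge0 opprK.
apply: le_trans (pD x (- x)); rewrite subrr.
by have := pD 0 0; rewrite addr0 -[X in X <= _]addr0 lerD2l.
Qed.

Lemma sublinearZ p r x : sublinear p -> 0 <= r -> p (r *: x) = r * p x.
Proof.
move=> sp; have [pD pZ] := sp; rewrite le_eqVlt => /predU1P[<-|r0].
  rewrite scale0r mul0r; apply/eqP; rewrite eq_le sublinear0_le//=.
  have := sublinear_geN 0 sp.
  by rewrite oppr0 -subr_ge0 opprK -mulr2n pmulrn_lge0.
apply/eqP; rewrite eq_le (pZ _ _ (ltW r0))/= -ler_pdivlMl//.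
by rewrite -[X in p X <= _](scalerK (lt0r_neq0 r0)) pZ// invr_ge0 ltW.
Qed.

(** The minorant [m] keeps the infima finite. The other conditions compare different members of [A],
    since the functionals [f t] in [sublinear_lower] need not be sublinear one by one. *)
Lemma sublinear_inf (A : set (V -> R)) (m : V -> R) :
  A !=set0 -> (forall q x, A q -> m x <= q x) ->
  (forall q q' x y, A q -> A q' ->
     exists2 s, A s & s (x + y) <= q x + q' y) ->
  (forall q r x, A q -> 0 <= r -> exists2 s, A s & s (r *: x) <= r * q x) ->
  let i x := inf [set q x | q in A] in
  sublinear i /\ forall q x, A q -> i x <= q x.
Proof.
move=> [q0 Aq0] lbA AD AZ i.
have i_le q x : A q -> i x <= q x.
  move=> Aq; apply: ge_inf; last by exists q.
  by exists (m x) => _ [s As <-]; exact: lbA.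
have le_i c x : (forall q, A q -> c <= q x) -> c <= i x.
  move=> cA; apply: lb_le_inf; first by exists (q0 x), q0.
  by move=> _ [q Aq <-]; exact: cA.
split => //; split=> [x y|r x r0].
  rewrite -lerBlDr; apply: (le_i) => q Aq; rewrite lerBlDr -lerBlDl.
  apply: (le_i) => q' Aq'; rewrite lerBlDl.
  by have [s As] := AD _ _ x y Aq Aq'; exact: le_trans (i_le _ _ As).
move: r0; rewrite le_eqVlt => /predU1P[<-|r0].
  have [s As] := AZ _ 0 x Aq0 (lexx _).
  by rewrite !mul0r => s0; exact: le_trans (i_le _ _ As) s0.
rewrite -ler_pdivrMl//; apply: le_i => q Aq; rewrite ler_pdivrMl//.
by have [s As] := AZ _ _ x Aq (ltW r0); exact: le_trans (i_le _ _ As).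
Qed.

(* Pushing [p] in the direction [x] yields a smaller sublinear functional whose
   value at [- x] is at most [- p x], the least one possible. *)
Lemma sublinear_lower p x : sublinear p ->
  exists q, [/\ sublinear q, forall y, q y <= p y &
    forall y, q y <= p (y + x) - p x].
Proof.
move=> sp; have [pD pZ] := sp.
pose f (t : R) y := p (y + t *: x) - t * p x.
have [||||sq q_le] :=
    @sublinear_inf [set f t | t in [set t | 0 <= t]] (fun y => - p (- y)).
- by exists (f 0), 0 => /=.
(* Here [t * p x = p (t *: x)], and [t *: x] is the sum of [y + t *: x] and [- y]. *)
- move=> _ y [t /= t0 <-]; rewrite /f -sublinearZ// lerBrDr -lerBrDl opprK.
  by apply: le_trans (pD _ _); rewrite addrAC subrr add0r.
- move=> _ _ y z [s /= s0 <-] [t /= t0 <-]; exists (f (s + t)).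
    by exists (s + t) => //=; rewrite addr_ge0.
  rewrite /f scalerDl mulrDl opprD addrACA [X in _ <= X]addrACA lerD2r.
  exact: pD.
- move=> _ r y [t /= t0 <-] r0; exists (f (r * t)).
    by exists (r * t) => //=; rewrite mulr_ge0.
  by rewrite /f -scalerA -scalerDr mulrBr mulrA lerD2r pZ.
exists (fun y => inf [set g y | g in [set f t | t in [set t | 0 <= t]]]).
split=> // y.
  (* The members [f 0] and [f 1] of the family give the two bounds. *)
  have -> : p y = f 0 y by rewrite /f scale0r mul0r addr0 subr0.
  by apply: q_le; exists 0 => /=.
have -> : p (y + x) - p x = f 1 y by rewrite /f scale1r mul1r.
by apply: q_le; exists 1 => /=.
Qed.

(** Zorn's lemma for the reversed pointwise order: a non-empty chain is bounded by its infimum,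
    finite because [- p (- x)] minorises every sublinear functional below [p]. *)
Lemma sublinear_minimal p : sublinear p ->
  exists q, [/\ sublinear q, forall y, q y <= p y &
    forall s, sublinear s -> (forall y, s y <= q y) -> s = q].
Proof.
move=> sp.
pose T := {q | sublinear q /\ forall y, q y <= p y}.
have [||||[q [sq qp]] qmin] :=
    @Zorn T (fun a b => `[< forall y, sval b y <= sval a y >]).
- by move=> a; apply/asboolP.
- move=> a b c /asboolP ba /asboolP cb; apply/asboolP => y.
  exact: le_trans (cb y) (ba y).
- move=> [a Pa] [b Pb] /asboolP/= ba /asboolP/= ab; apply/eq_exist/funext => y.
  by apply/eqP; rewrite eq_le ab ba.
- move=> A totA; have [[a Aa]|A0] := pselect (A !=set0); last first.
    (* The empty chain, to which [sublinear_inf] does not apply, is bounded by [p]. *)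
    have Pp : sublinear p /\ forall y, p y <= p y by split.
    by exists (exist _ p Pp) => s As; case: A0; exists s.
  have [||||si i_le] :=
      @sublinear_inf [set sval q | q in A] (fun y => - p (- y)).
  + by exists (sval a), a.
  + move=> _ x [[q [sq qp]] /= Aq <-].
    by apply: le_trans (sublinear_geN x sq); rewrite lerN2.
  + move=> _ _ x y [s As <-] [t At <-].
    have [[sD _] _] := svalP s; have [[tD _] _] := svalP t.
    (* Of two members of the chain, the smaller one serves for both. *)
    have [/asboolP st|/asboolP ts] := totA _ _ As At.
      exists (sval t); first by exists t.
      by apply: le_trans (tD x y) _; rewrite lerD2r.
    exists (sval s); first by exists s.
    by apply: le_trans (sD x y) _; rewrite lerD2l.
  + move=> _ r x [s As <-] r0; exists (sval s); first by exists s.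
    by have [[_ sZ] _] := svalP s; exact: sZ.
  have Pi : sublinear (fun x => inf [set g x | g in [set sval q | q in A]]) /\
      forall y, inf [set g y | g in [set sval q | q in A]] <= p y.
    split=> // y; have [_ ap] := svalP a.
    by apply: le_trans (ap y); apply: i_le; exists a.
  pose P q := sublinear q /\ forall y, q y <= p y.
  by exists (exist P _ Pi) => s As; apply/asboolP => y /=; apply: i_le; exists s.
exists q; split=> // s ss sq'.
have Ps : sublinear s /\ forall y, s y <= p y.
  by split=> // y; exact: le_trans (sq' y) (qp y).
by have /(_ (asboolT sq'))[] := qmin (exist _ s Ps).
Qed.

(** Additivity comes from minimality applied to the functional of [sublinear_lower]; it makes [q]
    odd, which settles negative scalars. *)
Lemma sublinear_minimal_linear q : sublinear q ->
  (forall s, sublinear s -> (forall y, s y <= q y) -> s = q) ->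
  scalar q.
Proof.
move=> sq qmin; have [qD qZ] := sq.
have qDE x y : q (x + y) = q x + q y.
  apply/eqP; rewrite eq_le qD /=.
  have [s [ss /(qmin _ ss) -> /(_ y)]] := sublinear_lower x sq.
  by rewrite lerBrDr addrC [y + x]addrC.
have q0 : q 0 = 0 by have := sublinearZ 0 sq (lexx 0); rewrite scale0r mul0r.
have qN x : q (- x) = - q x.
  by apply/eqP; rewrite -addr_eq0 -qDE addNr q0.
move=> r x y; rewrite qDE; congr (_ + _).
have [r0|/ltW r0] := leP 0 r; first exact: sublinearZ.
rewrite -[r]opprK scaleNr qN sublinearZ ?oppr_ge0//.
by rewrite -mulNr opprK.
Qed.

(** Lowering [p] along [x] before minimising forces [q (- x) <= p 0 - p x <= - p x], hence
    [p x <= q x] by oddness. *)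
Theorem hahn_banach_sublinear p x : sublinear p ->
  exists q, [/\ scalar q, forall y, q y <= p y & q x = p x].
Proof.
move=> sp; have [p' [sp' p'p p'x]] := sublinear_lower x sp.
have [q [sq qp' qmin]] := sublinear_minimal sp'.
have lq := sublinear_minimal_linear sq qmin.
exists q; split=> // [y|]; first exact: le_trans (p'p y).
apply/eqP; rewrite eq_le (le_trans (qp' x) (p'p x))/=.
have qN : q (- x) = - q x.
  have q0 : q 0 = 0 by have := lq (-1) 0 0; rewrite scaler0 addr0 mulN1r addNr.
  by have := lq (-1) x 0; rewrite scaleN1r addr0 mulN1r q0 addr0.
rewrite -lerN2 -qN; apply: le_trans (qp' _) _; apply: le_trans (p'x _) _.
by rewrite addNr gerDr; exact: sublinear0_le.
Qed.

End HahnBanach.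

(** * Restriction of scalars to [R], on an alias so that both module structures coexist *)

Definition realification (R : realType) (V : lmodType R[i]) : Type := V.

Section Realification.
Variables (R : realType) (V : lmodType R[i]).

HB.instance Definition _ := GRing.Zmodule.on (realification V).

Let real_scale (r : R) (x : realification V) : realification V := r%:C *: (x : V).

Lemma real_scaleA a b x : real_scale a (real_scale b x) = real_scale (a * b) x.
Proof. by rewrite /real_scale scalerA rmorphM. Qed.

Lemma real_scale1 : left_id 1 real_scale.
Proof. by move=> x; rewrite /real_scale rmorph1 scale1r. Qed.

Lemma real_scaleDr : right_distributive real_scale +%R.
Proof. by move=> a x y; rewrite /real_scale scalerDr. Qed.

Lemma real_scaleDl x : {morph real_scale^~ x : a b / a + b}.
Proof. by move=> a b; rewrite /real_scale rmorphD scalerDl. Qed.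

HB.instance Definition _ := GRing.Zmodule_isLmodule.Build R (realification V)
  real_scaleA real_scale1 real_scaleDr real_scaleDl.

End Realification.

(** * Scalar multiples and rank-one operators *)

Section BopScale.
Variables (C : numFieldType) (V W : normedModType C).

Lemma bop_scale_linear (c : C) (A : 'B(V, W)) : linear (fun x => c *: A x).
Proof. by move=> a x y; rewrite linearP scalerDr !scalerA mulrC. Qed.

Lemma bop_scale_bounded (c : C) (A : 'B(V, W)) : bounded_map (fun x => c *: A x).
Proof.
have [M AM] := bop_bounded A; exists (`|c| * M) => x.
by rewrite normrZ -mulrA ler_wpM2l.
Qed.

Definition bop_scale c A : 'B(V, W) :=
  mk_bop (bop_scale_linear c A) (bop_scale_bounded c A).

Lemma bop_tensor_linear (f : 'B(V, C^o)) (w : W) : linear (fun x => (f x : C) *: w).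
Proof. by move=> a x y; rewrite linearP scalerDl scalerA. Qed.

Lemma bop_tensor_bounded (f : 'B(V, C^o)) (w : W) :
  bounded_map (fun x => (f x : C) *: w).
Proof.
have [M fM] := bop_bounded f; exists (M * `|w|) => x.
by rewrite normrZ mulrAC ler_wpM2r.
Qed.

Definition bop_tensor f w : 'B(V, W) :=
  mk_bop (bop_tensor_linear f w) (bop_tensor_bounded f w).

End BopScale.

(** * Bounded complex functionals separating vectors *)

Section ComplexFunctionals.
Variables (R : realType) (V : normedModType R[i]).
Implicit Types x y u v w : V.

(* A real-linear [q] is the real part of the complex-linear map
   [x |-> q x - i q (i x)]. *)
Lemma dual_separates u : u <> 0 -> exists f : 'B(V, R[i]^o), f u <> 0.
Proof.
(* The norm takes values in [R[i]]; its real part is the real functional that dominates. *)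
move=> u0; pose p x := complex.Re `|x|.
have pE x : `|x| = (p x)%:C by rewrite /p RRe_real// normr_real.
have sp : @sublinear R (realification V) p.
  split=> [x y|r x r0].
    by rewrite -lecR rmorphD/= -!pE ler_normD.
  have -> : r *: x = r%:C *: (x : V) by [].
  by rewrite -lecR rmorphM/= -!pE normrZ ger0_norm// lecR.
have [q [lq qp qu]] := @hahn_banach_sublinear R (realification V) p u sp.
have qD x y : q (x + y) = q x + q y.
  by have := lq 1 x y; rewrite scale1r mul1r.
have q0 : q 0 = 0 by apply: (addrI (q 0)); rewrite -qD !addr0.
have qZ (r : R) x : q (r%:C *: x) = r * q x.
  by have := lq r x 0; rewrite !addr0 q0 addr0.
have qN x : q (- x) = - q x.
  by rewrite -scaleN1r (_ : -1 = (-1)%:C) ?qZ ?mulN1r ?rmorphN1.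
have q_norm x : `|q x| <= p x.
  rewrite ler_norml qp andbT lerNl -qN; apply: le_trans (qp _) _.
  by rewrite /p normrN.
pose f x : R[i]^o := (q x +i* - q ('i *: x))%C.
have fl : linear f.
  move=> [a b] x y; rewrite /f.
  have complexD (c d : R) : (c +i* d)%C = c%:C + d%:C * 'i :> R[i] by simpc.
  have -> : 'i *: ((a +i* b)%C *: x + y) =
      a%:C *: ('i *: x) + (- b)%:C *: x + 'i *: y.
    by rewrite scalerDr !scalerA -scalerDl complexD; congr (_ *: x + _); simpc.
  have -> : (a +i* b)%C *: x = a%:C *: x + b%:C *: ('i *: x).
    by rewrite scalerA -scalerDl complexD.
  rewrite !qD !qZ; apply/eqP; rewrite eq_complex /=.
  by apply/andP; split; apply/eqP => /=; simpc; ring.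
have norm_i : `|'i| = 1 :> R[i].
  by rewrite normc_def /= expr0n expr1n add0r sqrtr1.
have norm_real (r : R) : `|r%:C| = `|r|%:C.
  by rewrite normc_def /= expr0n addr0 sqrtr_sqr.
have fb : bounded_map f.
  (* The real and the imaginary part of [f x] contribute one [|x|] each, as [|'i *: x| = |x|]. *)
  exists 2 => x.
  have -> : f x = (q x)%:C - (q ('i *: x))%:C * 'i by rewrite /f; simpc.
  apply: le_trans (ler_normB _ _) _; rewrite normrM norm_i mulr1 !norm_real.
  have -> : 2 * `|x| = `|x| + `|'i *: x| by rewrite normrZ norm_i mul1r mulr_natl.
  by rewrite !pE lerD// lecR.
(* The real part of [f u] is [q u = p u], the norm of [u]. *)
exists (mk_bop fl fb) => /(congr1 (@complex.Re R)) /=; rewrite qu => pu.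
by apply: u0; apply/eqP; rewrite -normr_eq0 pE pu.
Qed.

(** A Gram-Schmidt step: subtracting [f v *: u] moves [v] into the null space of [f], and a
    functional equal to 1 at the result is corrected by a multiple of [f] to vanish at [u]. *)
Lemma exists_dual_basis u v : u <> 0 -> (forall a, v <> a *: u) ->
  exists w (f g : 'B(V, R[i]^o)), [/\ f u = 1, f w = 0, g u = 0 & g w = 1].
Proof.
have dual1 x : x <> 0 -> exists f : 'B(V, R[i]^o), f x = 1.
  move=> /dual_separates[f fx]; exists (bop_scale (f x)^-1 f).
  by rewrite /= /GRing.scale /= mulVf//; apply/eqP.
move=> /dual1[f fu] vu; pose w := v - (f v : R[i]) *: u.
have fw : f w = 0 by rewrite linearB linearZ_LR fu /GRing.scale /= mulr1 subrr.
have [|g gw] := dual1 w; first by move/subr0_eq/vu.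
exists w, f, (g - bop_scale (g u) f); split=> //; rewrite bopBE /=.
  by rewrite fu /GRing.scale /= mulr1 subrr.
by rewrite fw scaler0 subr0.
Qed.

End ComplexFunctionals.

(** * Uncountability and the dimension hypothesis *)

Lemma uncountable_real (R : realType) : ~ countable [set: R].
Proof.
(* Countable sets are Lebesgue null, whereas the line has infinite measure. *)
move=> /countable_lebesgue_measure0/eqP.
by rewrite -set_itvNyy lebesgue_measure_itv/=.
Qed.

Lemma uncountable_inj (T U : Type) (A : set T) (B : set U) (f : T -> U) :
  {in A &, injective f} -> (forall x, A x -> B (f x)) ->
  ~ countable A -> ~ countable B.
Proof.
move=> finj AB ncA /countable_injP[g ginj]; apply/ncA/countable_injP.
exists (g \o f) => x y Ax Ay /ginj fxy; apply: finj => //.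
by apply: fxy; apply/mem_set/AB/set_mem.
Qed.

(** Otherwise the singleton of [u] would span [V], and its span would be dense. *)
Lemma banach_dim_ge2_span (C : numFieldType) (V : normedModType C) (u : V) :
  banach_dim_ge V 2 -> exists v, forall a, v <> a *: u.
Proof.
move=> dV; apply: contrapT => nv.
have /dV : dense (linear_span [set u]).
  suff -> : linear_span [set u] = setT by move=> O [x Ox] _; exists x.
  apply/seteqP; split=> // x _ S [[S0 SP] Su].
  have [a ->] : exists a, x = a *: u.
    by apply: contrapT => /forallNP xu; apply: nv; exists x.
  by rewrite -[_ *: _]addr0; apply: SP => //; exact: Su.
by rewrite (card_le_eqr card_set1) card_le_II.
Qed.

(** * Composition laws for bounded operators *)

Section BopAlgebra.
Variables (C : numFieldType) (U V W : normedModType C).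

Lemma bop_compE (A : 'B(V, W)) (B : 'B(U, V)) x : (A \ob B) x = A (B x).
Proof. by []. Qed.

Lemma bop_comp0 (A : 'B(V, W)) : A \ob (0 : 'B(U, V)) = 0.
Proof. by apply: bopP => x /=; rewrite linear0. Qed.

Lemma bop_0comp (A : 'B(U, V)) : (0 : 'B(V, W)) \ob A = 0.
Proof. exact: bopP. Qed.

Lemma bop_comp1 (A : 'B(V, W)) : A \ob bop_id V = A.
Proof. exact: bopP. Qed.

Lemma bop_1comp (A : 'B(V, W)) : bop_id W \ob A = A.
Proof. exact: bopP. Qed.

End BopAlgebra.

(** * Block operator calculus *)

Section Blocks.
Variables (C : numFieldType) (X : normedModType C).
Variables (K L : closed_subspace X) (h : topological_sum K L).

Lemma block_comp (A1 B1 : 'B(K)) (A2 B2 : 'B(L, K)) (A3 B3 : 'B(K, L))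
    (A4 B4 : 'B(L)) :
  block h A1 A2 A3 A4 \ob block h B1 B2 B3 B4 =
  block h (A1 \ob B1 + A2 \ob B3) (A1 \ob B2 + A2 \ob B4)
          (A3 \ob B1 + A4 \ob B3) (A3 \ob B2 + A4 \ob B4).
Proof.
apply: block_unique => k l; rewrite bop_compE !blockE /= !linearD /=.
by congr (_ + _); exact: addrACA.
Qed.

(** The projections separate the two rows, and zero arguments separate the columns. *)
Lemma block_inj (A1 B1 : 'B(K)) (A2 B2 : 'B(L, K)) (A3 B3 : 'B(K, L))
    (A4 B4 : 'B(L)) :
  block h A1 A2 A3 A4 = block h B1 B2 B3 B4 ->
  [/\ A1 = B1, A2 = B2, A3 = B3 & A4 = B4].
Proof.
move=> AB; have ABE k l : A1 k + A2 l = B1 k + B2 l /\ A3 k + A4 l = B3 k + B4 l.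
  have /(congr1 (fun A : 'B(X) => A (val k + val l))) := AB.
  rewrite !blockE => ABkl.
  have := congr1 (left_proj h) ABkl; have := congr1 (right_proj h) ABkl.
  by rewrite !left_projE !right_projE.
split; apply: bopP => x.
- by have [+ _] := ABE x 0; rewrite !linear0 !addr0.
- by have [+ _] := ABE 0 x; rewrite !linear0 !add0r.
- by have [_ +] := ABE x 0; rewrite !linear0 !addr0.
- by have [_ +] := ABE 0 x; rewrite !linear0 !add0r.
Qed.

End Blocks.

(** * Idempotents and their null spaces *)

Section Idempotents.
Variables (C : numFieldType) (V W : normedModType C).

(** The null space of an idempotent [D] is the range of [I - D], so the inclusion says
    [A (I - D) = 0]. *)
Lemma idem_bop_ker_sub (D : 'B(V)) (A : 'B(V, W)) : idem_bop D ->
  (bop_ker D `<=` bop_ker A) <-> A \ob D = A.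
Proof.
move=> DD; split=> [DA|<- x Dx]; last by rewrite /bop_ker /= Dx linear0.
apply: bopP => x /=; have DDx : D (D x) = D x := congr1 (fun B : 'B(V) => B x) DD.
have /DA : bop_ker D (x - D x) by rewrite /bop_ker /= linearB /= DDx subrr.
by rewrite /bop_ker /= linearB => /subr0_eq.
Qed.

End Idempotents.

Lemma bop_ker_nontrivial (C : numFieldType) (V W : normedModType C) (A : 'B(V, W)) :
  bop_ker A <> [set 0] <-> exists2 u, u <> 0 & A u = 0.
Proof.
split=> [A0|[u u0 Au] A0]; last by apply: u0; have : bop_ker A u by []; rewrite A0.
apply: contrapT => nA; apply: A0; apply/seteqP; split=> [u Au|_ ->] /=.
  by apply: contrapT => u0; apply: nA; exists u.
exact: linear0.
Qed.

(* The projections [x |-> x - (f + t g)(x) u] along [u], where [f u = 1],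
   [g u = 0] and [g <> 0]: they are pairwise distinct for [t] real. *)
Lemma uncountable_idem_bop_ker (R : realType) (V : normedModType R[i]) (u : V) :
  banach_dim_ge V 2 -> u <> 0 ->
  ~ countable [set D : 'B(V) | idem_bop D /\ bop_ker D = range ( *:%R^~ u)].
Proof.
move=> dV u0; have [v vu] := banach_dim_ge2_span u dV.
have [w [f [g [fu fw gu gw]]]] := exists_dual_basis u0 vu.
pose ft (t : R) : 'B(V, R[i]^o) := f + bop_scale t%:C g.
have ftu t : ft t u = 1 by rewrite bopDE /= gu scaler0 addr0.
have ftw t : ft t w = t%:C by rewrite bopDE /= fw gw add0r /GRing.scale /= mulr1.
have ftZ t a : ft t (a *: u) = a by rewrite linearZ_LR ftu /GRing.scale /= mulr1.
pose D t : 'B(V) := bop_id V - bop_tensor (ft t) u.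
have DE t x : D t x = x - (ft t x : R[i]) *: u by [].
apply: (@uncountable_inj _ _ _ _ D _ _ (@uncountable_real R)) => [s t _ _|t _].
  (* Since [D t w = w - t u] and [u] is non-zero, the value at [w] determines [t]. *)
  move=> /(congr1 (fun A : 'B(V) => A w)); rewrite !DE !ftw => /addrI/oppr_inj/eqP.
  rewrite -subr_eq0 -scalerBl scaler_eq0 subr_eq0.
  by move=> /orP[/eqP[]|/eqP].
split.
  by apply: bopP => x; rewrite bop_compE !DE linearB ftZ subrr scale0r subr0.
apply/seteqP; split=> [x|_ [a _ <-]]; rewrite /bop_ker /mkset DE.
  by move/subr0_eq => ->; exists (ft t x).
by rewrite ftZ subrr.
Qed.

Theorem theorem4p10 (R : realType) (X : completeNormedModType R[i])
    (T : 'B(X)) (K L : closed_subspace X) (h : topological_sum K L)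
    (T1 : 'B(K)) (T2 : 'B(L, K)) :
  T <> 0 -> T <> bop_id X ->
  (exists A : 'B(X), A <> 0 /\ A \ob T = 0) ->
  (exists A : 'B(X), A <> 0 /\ T \ob A = 0) ->
  local_block_rep h T T1 T2 ->
  idem_bop T1 -> T1 <> bop_id K ->
  (bop_ker T2 <> [set 0] \/ range T1 `&` range T2 <> [set 0]) ->
  banach_dim_ge L 2 ->
  let E1 := block h (bop_id K) T2 0 0 in
  let E2 (D : 'B(L)) := block h T1 (T2 \ob (bop_id L - D)) 0 D in
  let E1' (D : 'B(L)) := block h (bop_id K) (T2 \ob D) 0 0 in
  [/\ ~ countable [set D : 'B(L) | admissible T1 T2 D],
      forall D : 'B(L), admissible T1 T2 D ->
        [/\ idem_bop E1, idem_bop (E2 D), idem_bop (E1' D),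
            T = E1 \ob E2 D & T = E1' D \ob E2 D],
      forall D : 'B(L), admissible T1 T2 D ->
        (E1 = E1' D <-> bop_ker D `<=` bop_ker T2) /\
        (E1 = E1' D -> bop_ker T2 <> [set 0]),
      forall D D' : 'B(L), admissible T1 T2 D -> admissible T1 T2 D' ->
        D <> D' -> E2 D <> E2 D' &
      ~ countable [set EF : 'B(X) * 'B(X) |
                    [/\ idem_bop EF.1, idem_bop EF.2 & T = EF.1 \ob EF.2]]].
Proof.
move=> _ _ _ _ [_ TE] T1T1 _ kerT2 dL E1 E2 E1'.
have T1T1E k : T1 (T1 k) = T1 k := congr1 (fun A : 'B(K) => A k) T1T1.
have [u u0 Su] : exists2 u, u <> 0 & (T2 - T1 \ob T2) u = 0.
  have [/bop_ker_nontrivial[u u0 T2u]|T12] := kerT2.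
    by exists u => //; rewrite bopBE /= T2u linear0 subrr.
  apply: contrapT => nu; apply: T12; apply/seteqP; split; last first.
    by move=> _ ->; split; exists 0 => //; exact: linear0.
  (* If [T2 l = T1 k] is non-zero, then so is [l], and [T1 (T2 l) = T1 (T1 k) = T2 l]. *)
  move=> _ [[k _ <-] [l _ T2l]] /=; apply: contrapT => T1k.
  apply: nu; exists l => [l0|]; first by apply: T1k; rewrite -T2l l0 linear0.
  by rewrite bopBE /= T2l T1T1E subrr.
have ncD : ~ countable [set D : 'B(L) | admissible T1 T2 D].
  (* A vector off the line of [u] shows that this line, the null space of [D], is not all of [L]. *)
  have [v vu] := banach_dim_ge2_span u dL.
  apply: uncountable_inj (uncountable_idem_bop_ker dL u0).
    by move=> D D' _ _; exact: id.
  move=> D [DD Du].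
  split=> //; rewrite Du.
  - move=> u00; apply: u0; have : range ( *:%R^~ u) u.
      by exists 1; rewrite ?scale1r.
    by rewrite u00.
  - by move=> uT; have [a _ /esym/vu] : range ( *:%R^~ u) v by rewrite uT.
  - by move=> _ [a _ <-]; rewrite /bop_ker /mkset linearZ_LR Su scaler0.
have factors D : admissible T1 T2 D ->
    [/\ idem_bop E1, idem_bop (E2 D), idem_bop (E1' D),
        T = E1 \ob E2 D & T = E1' D \ob E2 D].
  move=> [DD _ _ kerD].
  have DDE l : D (D l) = D l := congr1 (fun A : 'B(L) => A l) DD.
  (* The range of [I - D] lies in the null space of [D], where [T2] and [T1 T2] agree. *)
  have T2D l : T1 (T2 (l - D l)) = T2 (l - D l).
    have /kerD : bop_ker D (l - D l) by rewrite /bop_ker /= linearB DDE subrr.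
    by move/subr0_eq.
  split; rewrite /idem_bop ?TE block_comp;
    rewrite ?(bop_comp0, bop_0comp, bop_1comp, bop_comp1) ?(addr0, add0r, T1T1, DD) //;
    congr (block h _ _ _ _); apply: bopP => x.
  (* Only upper right entries remain: for the square of [E2 D], where [(I - D) D = 0], then for the
     two factorisations, where [T2 (I - D) + T2 D = T2]. *)
  - by rewrite bopDE !bop_compE !bopBE T2D DDE subrr linear0 addr0.
  - by rewrite bopDE !bop_compE bopBE -linearD subrK.
  - by rewrite bopDE !bop_compE bopBE DDE -linearD subrK.
have E2_inj D D' : E2 D = E2 D' -> D = D' by case/block_inj.
split=> //.
- move=> D [DD D0 _ _].
  have E1E1' : E1 = E1' D <-> bop_ker D `<=` bop_ker T2.
    (* Both sides amount to [T2 D = T2], on the left by comparing upper right entries. *)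
    rewrite (idem_bop_ker_sub T2 DD); split=> [/block_inj[]|TD] //.
    by rewrite /E1' TD.
  split=> // /E1E1' DT2; move/bop_ker_nontrivial: D0 => [v v0 Dv].
  by apply/bop_ker_nontrivial; exists v => //; exact: DT2.
- by move=> D D' _ _ DD' /E2_inj.
(* The first factor stays fixed; the second alone distinguishes the pairs. *)
- apply: (uncountable_inj (f := fun D => (E1, E2 D)) _ _ ncD) => [D D' _ _|D].
    by move=> /(congr1 snd)/E2_inj.
  by case/factors.
Qed.
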